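(* Fix $N\ge1$, $L>0$ and $\lambda>0$, and let $I=\{0,1,\dots,N,*\}$. Then $\mathrm{val}(\mathrm{PEP})=\mathrm{val}(\overline{\mathrm{PEP}})$, and this common value equals the optimal value of the semidefinite program (SDP) described below.
   Context: $\mathcal{B}_L(\mathbb{R}^n)$ is the set of pairs $f,h:\mathbb{R}^n\to\mathbb{R}$ such that $f$ is convex, differentiable and has at least one minimizer; $h$ is strictly convex and differentiable; $Lh-f$ is convex; and for every $\lambda'>0$, $x,p\in\mathbb{R}^n$ the function $u\mapsto\langle p,u-x\rangle+\frac1{\lambda'}D_h(u,x)$ has a unique minimizer, with $D_h(u,x)=h(u)-h(x)-\langle\nabla h(x),u-x\rangle$. (PEP) is the supremum of $\big(f(x_N)-f(x_* )\big)/D_h(x_*,x_0)$ (with convention $0/0=0$) over all $n\ge1$, $(f,h)\in\mathcal{B}_L(\mathbb{R}^n)$, $x_0\in\mathbb{R}^n$, minimizers $x_*$ of $f$, where $x_1,\dots,x_N$ are the NoLips iterates $x_{k+1}=\operatorname{argmin}_u\langle\nabla f(x_k),u-x_k\rangle+\frac1\lambda D_h(u,x_k)$. $(\overline{\mathrm{PEP}})$ is the supremum of $f_N-f_*$ over all $n\ge1$ and $\{(x_i,f_i,g_i,h_i,s_i)\}_{i\in I}\subset(\mathbb{R}^n\times\mathbb{R}\times\mathbb{R}^n\times\mathbb{R}\times\mathbb{R}^n)$ such that: there exist $f,h:\mathbb{R}^n\to\mathbb{R}$ with $f$ and $Lh-f$ convex and $f_i=f(x_i)$, $g_i\in\partial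 f(x_i)$, $h_i=h(x_i)$, $s_i\in\partial h(x_i)$, $Ls_i-g_i\in\partial(Lh-f)(x_i)$ for all $i\in I$; $g_*=0$; $s_{i+1}=s_i-\lambda g_i$ for $i\in\{0,\dots,N-1\}$; and $h_*-h_0-\langle s_0,x_*-x_0\rangle=1$. (SDP) is: maximize $f_N-f_*$ over $F=(f_0,\dots,f_N,f_* )\in\mathbb{R}^{N+2}$, $H=(h_0,\dots,h_N,h_* )\in\mathbb{R}^{N+2}$ and a symmetric positive semidefinite matrix $G$ of size $3(N+2)$ whose rows/columns are indexed by pairs $(a,i)$ with $a\in\{x,g,s\}$, $i\in I$ (write $G^{ab}_{ij}$ for the entry at $((a,i),(b,j))$), subject to: for all $i,j\in I$, $f_i-f_j-G^{gx}_{ji}+G^{gx}_{jj}\ge0$ and $(Lh_i-f_i)-(Lh_j-f_j)-L(G^{sx}_{ji}-G^{sx}_{jj})+G^{gx}_{ji}-G^{gx}_{jj}\ge0$; $G^{gg}_{**}=0$; $G^{sx}_{i+1,j}=G^{sx}_{ij}-\lambda G^{gx}_{ij}$ for $i\in\{0,\dots,N-1\}$, $j\in I$; and $h_*-h_0-G^{sx}_{0*}+G^{sx}_{00}=1$. *)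

(* Defs.v *)
From HB Require Import structures.
From mathcomp Require Import all_boot all_order all_algebra.
From mathcomp Require Import all_classical all_reals all_analysis.
Set Implicit Arguments. Unset Strict Implicit. Unset Printing Implicit Defensive.
Import Order.TTheory GRing.Theory Num.Theory.
Import numFieldNormedType.Exports.
Local Open Scope ring_scope.
Local Open Scope classical_set_scope.

Section Defs.
Variable R : realType.

Definition dotv n (u v : 'rV[R]_n) : R := \sum_(i < n) u ord0 i * v ord0 i.

Definition convex_fun n (f : 'rV[R]_n -> R) : Prop :=
  forall (x y : 'rV[R]_n) (t : R), 0 <= t <= 1 ->
    f (t *: x + (1 - t) *: y) <= t * f x + (1 - t) * f y.

Definition strictly_convex_fun n (f : 'rV[R]_n -> R) : Prop :=
  forall (x y : 'rV[R]_n) (t : R), x != y -> 0 < t < 1 ->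
    f (t *: x + (1 - t) *: y) < t * f x + (1 - t) * f y.

Definition differentiable_fun n (f : 'rV[R]_n -> R^o) : Prop :=
  forall x, differentiable f x.

Definition grad n (f : 'rV[R]_n -> R^o) (x : 'rV[R]_n) : 'rV[R]_n :=
  \row_i ('d f x (delta_mx 0 i : 'rV[R]_n) : R).

Definition is_minimizer n (f : 'rV[R]_n -> R) (x : 'rV[R]_n) : Prop :=
  forall y, f x <= f y.

Definition Dh n (h : 'rV[R]_n -> R) (u x : 'rV[R]_n) : R :=
  h u - h x - dotv (grad h x) (u - x).

Definition B_L (L : R) n (f h : 'rV[R]_n -> R) : Prop :=
  [/\ convex_fun f /\ differentiable_fun f /\ (exists x, is_minimizer f x),
      strictly_convex_fun h /\ differentiable_fun h,
      convex_fun (fun x => L * h x - f x) &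
      (forall (lam' : R) (x p : 'rV[R]_n), 0 < lam' ->
        exists! u, is_minimizer (fun u => dotv p (u - x) + lam'^-1 * Dh h u x) u)].

Definition nolips_iterates (lam : R) n (f h : 'rV[R]_n -> R) (N : nat)
  (x0 : 'rV[R]_n) (xs : nat -> 'rV[R]_n) : Prop :=
  xs 0%N = x0 /\
  forall k, (k < N)%N ->
    is_minimizer (fun u => dotv (grad f (xs k)) (u - xs k) + lam^-1 * Dh h u (xs k))
                 (xs k.+1).

(* Set of values of the performance ratio in (PEP).  Division by 0 gives 0
   in MathComp, which implements the convention 0/0 = 0. *)
Definition PEP_values (N : nat) (L lam : R) : set R :=
  [set r | exists (n : nat) (f h : 'rV[R]_n -> R) (x0 xstar : 'rV[R]_n)
                  (xs : nat -> 'rV[R]_n),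
     [/\ (1 <= n)%N, B_L L f h, is_minimizer f xstar,
         nolips_iterates lam f h N x0 xs &
         r = (f (xs N) - f xstar) / Dh h xstar x0]].

Definition val_PEP (N : nat) (L lam : R) : \bar R :=
  ereal_sup [set r%:E | r in PEP_values N L lam].

(* Index set I = {0, ..., N, * } : Some k encodes k, None encodes * *)
Definition Iset (N : nat) := option 'I_N.+1.
Definition idx (N k : nat) : Iset N := Some (inord k).
Definition istar (N : nat) : Iset N := None.

Definition subdiff n (f : 'rV[R]_n -> R) (x : 'rV[R]_n) : set 'rV[R]_n :=
  [set g | forall y, f x + dotv g (y - x) <= f y].

Definition PEPbar_values (N : nat) (L lam : R) : set R :=
  [set r | exists (n : nat) (x : Iset N -> 'rV[R]_n) (fv : Iset N -> R)
                  (g : Iset N -> 'rV[R]_n) (hv : Iset N -> R) (s : Iset N -> 'rV[R]_n),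
     [/\ (1 <= n)%N,
         (exists f h : 'rV[R]_n -> R,
           [/\ convex_fun f, convex_fun (fun y => L * h y - f y) &
               forall i, [/\ fv i = f (x i), subdiff f (x i) (g i), hv i = h (x i),
                             subdiff h (x i) (s i) &
                             subdiff (fun y => L * h y - f y) (x i) (L *: s i - g i)]]),
         g (istar N) = 0 /\
         (forall k, (k < N)%N -> s (idx N k.+1) = s (idx N k) - lam *: g (idx N k)),
         (hv (istar N) - hv (idx N 0) - dotv (s (idx N 0)) (x (istar N) - x (idx N 0)) = 1) &
         r = fv (idx N N) - fv (istar N)]].

Definition val_PEPbar (N : nat) (L lam : R) : \bar R :=
  ereal_sup [set r%:E | r in PEPbar_values N L lam].

(* SDP: the Gram matrix G has rows/columns indexed by pairs (a, i), a in {x,g,s}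
   encoded as 'I_3 (0 = x, 1 = g, 2 = s), i in I.  It is a square matrix of size
   3(N+2) = #|'I_3 * I|, represented as a function of two indices. *)
Definition cx : 'I_3 := inord 0.
Definition cg : 'I_3 := inord 1.
Definition cs : 'I_3 := inord 2.

Definition sym_psd (K : finType) (G : K -> K -> R) : Prop :=
  (forall k l, G k l = G l k) /\
  (forall v : K -> R, 0 <= \sum_(k : K) \sum_(l : K) v k * G k l * v l).

Definition SDP_values (N : nat) (L lam : R) : set R :=
  [set r | exists (F H : Iset N -> R) (G : ('I_3 * Iset N)%type -> ('I_3 * Iset N)%type -> R),
     let GG a i b j := G (a, i) (b, j) in
     [/\ sym_psd G,
         (forall i j : Iset N,
           F i - F j - GG cg j cx i + GG cg j cx j >= 0 /\
           (L * H i - F i) - (L * H j - F j) - L * (GG cs j cx i - GG cs j cx j)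
             + GG cg j cx i - GG cg j cx j >= 0),
         GG cg (istar N) cg (istar N) = 0 /\
         (forall k, (k < N)%N -> forall j : Iset N,
             GG cs (idx N k.+1) cx j = GG cs (idx N k) cx j - lam * GG cg (idx N k) cx j),
         (H (istar N) - H (idx N 0) - GG cs (idx N 0) cx (istar N) + GG cs (idx N 0) cx (idx N 0) = 1)
         & r = F (idx N N) - F (istar N)]].

Definition val_SDP (N : nat) (L lam : R) : \bar R :=
  ereal_sup [set r%:E | r in SDP_values N L lam].

End Defs.

(* Main.v *)
(* Every constraint involves the vectors only through the pairings <g_j, x_i>
   and <s_j, x_i>, in which it is linear.  Placing the x_i at the canonical basis
   of R^I turns any solution of this linear system into vectors, and maxima of
   affine functions interpolate them, so (PEP-bar) and (SDP) both amount to the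
   linear system; positive semidefiniteness only serves to get <g_*, x_i> = 0
   from |g_*|^2 = 0.  For (PEP), mix a solution with a small multiple of a
   strictly feasible one (gradient descent on a quadratic): strict inequalities
   allow interpolation by convex differentiable functions, built from smoothed
   maxima, and leave room for a quadratic term making h strictly convex and
   coercive, so that the resulting pair belongs to B_L. *)
Require Import Defs.
From HB Require Import structures.
From mathcomp Require Import all_boot all_order all_algebra.
From mathcomp Require Import all_classical all_reals all_analysis.
From mathcomp Require Import ring lra.
Set Implicit Arguments.
Unset Strict Implicit.
Unset Printing Implicit Defensive.
Import Order.TTheory GRing.Theory Num.Theory.
Import numFieldNormedType.Exports.
Local Open Scope ring_scope.

(** * Algebra and differentiability of the inner product *)

Section Dot.
Context {R : realType} {n : nat}.
Implicit Types u v w : 'rV[R]_n.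

Lemma dotvC u v : dotv u v = dotv v u.
Proof. by apply: eq_bigr => i _; rewrite mulrC. Qed.

Lemma dotvDl u v w : dotv (u + v) w = dotv u w + dotv v w.
Proof. by rewrite -big_split; apply: eq_bigr => i _; rewrite mxE mulrDl. Qed.

Lemma dotvZl a u w : dotv (a *: u) w = a * dotv u w.
Proof. by rewrite mulr_sumr; apply: eq_bigr => i _; rewrite mxE mulrA. Qed.

Lemma dotvBl u v w : dotv (u - v) w = dotv u w - dotv v w.
Proof. by rewrite dotvDl -scaleN1r dotvZl mulN1r. Qed.

Lemma dotvDr u v w : dotv w (u + v) = dotv w u + dotv w v.
Proof. by rewrite !(dotvC w) dotvDl. Qed.

Lemma dotvZr a u w : dotv w (a *: u) = a * dotv w u.
Proof. by rewrite !(dotvC w) dotvZl. Qed.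

Lemma dotvBr u v w : dotv w (u - v) = dotv w u - dotv w v.
Proof. by rewrite !(dotvC w) dotvBl. Qed.

Lemma dotv0l w : dotv 0 w = 0.
Proof. by rewrite -(scale0r 0) dotvZl mul0r. Qed.

Lemma dotv0r w : dotv w 0 = 0.
Proof. by rewrite dotvC dotv0l. Qed.

Lemma dotv_delta u (i : 'I_n) : dotv u (delta_mx 0 i) = u ord0 i.
Proof.
rewrite /dotv (bigD1 i) //= mxE !eqxx mulr1 big1 ?addr0 // => j ji.
by rewrite mxE (negbTE ji) andbF mulr0.
Qed.

Lemma dotv_ge0 u : 0 <= dotv u u.
Proof. by apply: sumr_ge0 => i _; rewrite -expr2 sqr_ge0. Qed.

Lemma dotv_gt0 u : u != 0 -> 0 < dotv u u.
Proof.
move=> u0; rewrite lt_neqAle dotv_ge0 andbT eq_sym; apply: contra u0 => /eqP.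
move/psumr_eq0P => h; apply/eqP/rowP => i; rewrite mxE.
by apply/eqP; rewrite -sqrf_eq0 expr2 h // => j _; rewrite -expr2 sqr_ge0.
Qed.

Lemma differentiable_dotv (g u : 'rV[R]_n) :
  differentiable (fun x => dotv g x : R^o) u.
Proof.
have -> : (fun x => dotv g x : R^o) =
    \sum_(i < n) (fun x : 'rV[R]_n => g ord0 i *: (x ord0 i : R^o)).
  by apply: boolp.funext => x; rewrite fct_sumE.
by apply: differentiable_sum => i; apply/differentiableZ/differentiable_coord.
Qed.

Lemma differentiable_dotvv u : differentiable (fun x => dotv x x : R^o) u.
Proof.
have -> : (fun x => dotv x x : R^o) =
    \sum_(i < n) (fun x : 'rV[R]_n => (x ord0 i * x ord0 i : R^o)).
  by apply: boolp.funext => x; rewrite fct_sumE.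
by apply: differentiable_sum => i; apply: differentiableM;
  exact: differentiable_coord.
Qed.

End Dot.

(** * Gradients, one-sided estimates and subgradients *)

Section Gradients.
Context {R : realType} {n : nat}.
Implicit Types (f : 'rV[R]_n -> R) (x y v g : 'rV[R]_n).

Lemma diff_dotv f x v : 'd (f : _ -> R^o) x v = dotv (grad f x) v.
Proof.
rewrite {1}(row_sum_delta v) linear_sum; apply: eq_bigr => i _.
by rewrite linearZ /= mxE mulrC.
Qed.

(** Multiplying out by [t] avoids quotients, and [t < 1] keeps the point on the segment where
    convexity inequalities apply. *)
Lemma difference_quotient_approx f x v (e : R) :
  differentiable (f : _ -> R^o) x -> 0 < e ->
  exists2 t, 0 < t < 1 &
    `|t * dotv (grad f x) v - (f (x + t *: v) - f x)| <= t * e.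
Proof.
move=> df e0.
have /cvg_ex[l /= cl] := @diff_derivable _ _ _ (f : _ -> R^o) x v df.
have el : l = dotv (grad f x) v.
  by rewrite -diff_dotv -deriveE //; apply/esym/cvg_lim.
move/cvgrPdist_lt: cl => /(_ e e0).
rewrite /dnbhs /= -nbhs_nearE => -[d /= d0 hd].
have m0 : 0 < Num.min d 1 by rewrite lt_min d0 ltr01.
have [md m1] : Num.min d 1 <= d /\ Num.min d 1 <= 1.
  by rewrite !ge_min !lexx orbT.
exists (Num.min d 1 / 2); first by lra.
set t := _ / 2; have t0 : 0 < t by rewrite /t; lra.
have /hd/(_ (lt0r_neq0 t0)) : ball_ Num.norm 0 d t.
  by rewrite /ball_ /= sub0r normrN gtr0_norm // /t; lra.
rewrite /= el [_ + x]addrC => /ltW h.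
rewrite -[X in _ - X](mulVKf (lt0r_neq0 t0)) -mulrBr normrM gtr0_norm //.
by rewrite ler_pM2l.
Qed.

Lemma grad_ge f x v (c : R) : differentiable (f : _ -> R^o) x ->
  (forall t, 0 < t < 1 -> t * c <= f (x + t *: v) - f x) ->
  c <= dotv (grad f x) v.
Proof.
move=> df h; rewrite leNgt; apply/negP => lc.
have [|t t01 ht] := @difference_quotient_approx f x v
    ((c - dotv (grad f x) v) / 2) df; first by lra.
have := h t t01; move: ht; rewrite ler_norml; nra.
Qed.

Lemma grad_le f x v (c : R) : differentiable (f : _ -> R^o) x ->
  (forall t, 0 < t < 1 -> f (x + t *: v) - f x <= t * c) ->
  dotv (grad f x) v <= c.
Proof.
move=> df h; rewrite leNgt; apply/negP => lc.
have [|t t01 ht] := @difference_quotient_approx f x v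
    ((dotv (grad f x) v - c) / 2) df; first by lra.
have := h t t01; move: ht; rewrite ler_norml; nra.
Qed.

(** Convexity bounds the increments along the segment towards [y] by [t * (f y - f x)], and
    [grad_le] passes to the limit. *)
Lemma grad_subdiff f x : convex_fun f -> differentiable (f : _ -> R^o) x ->
  subdiff f x (grad f x).
Proof.
move=> cf df y; rewrite -lerBrDl; apply: grad_le => // t /andP[t0 t1].
have := cf y x t; rewrite (ltW t0) (ltW t1) => /(_ isT).
have -> : t *: y + (1 - t) *: x = x + t *: (y - x).
  by rewrite scalerBl scalerBr scale1r addrCA.
by lra.
Qed.

(** A subgradient is below the gradient in every direction; opposite directions give equality. *)
Lemma subdiff_grad f x g : differentiable (f : _ -> R^o) x ->
  subdiff f x g -> grad f x = g.
Proof.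
move=> df sg.
have ge v : dotv g v <= dotv (grad f x) v.
  apply: grad_ge => // t _; have := sg (x + t *: v).
  by rewrite addrAC subrr add0r dotvZr; lra.
apply/rowP => i; rewrite -!dotv_delta; apply/le_anti; rewrite ge andbT.
by have := ge (- delta_mx 0 i); rewrite -scaleN1r !dotvZr; lra.
Qed.

Lemma gradZB f h (a : R) x : differentiable (f : _ -> R^o) x ->
  differentiable (h : _ -> R^o) x ->
  grad (fun y => a * h y - f y) x = a *: grad h x - grad f x.
Proof.
move=> df dh; apply/rowP => i; rewrite !mxE.
have -> : (fun y => a * h y - f y) = (a *: (h : _ -> R^o) - (f : _ -> R^o)).
  by [].
by rewrite diffB ?diffZ //; apply: differentiableZ.
Qed.

End Gradients.

(** * A differentiable, convexity-preserving smoothed maximum *)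

Section SmoothMax.
Context {R : realType}.
Implicit Types a b e t w : R.

(** The square of the positive part of [t], with derivative [2 * Num.max t 0]. *)
Definition sqpos t : R := t * Num.max t 0.

Lemma differentiable_sqpos t : differentiable (sqpos : R^o -> R^o) t.
Proof.
apply/derivable1_diffP.
apply/cvg_ex; exists (2 * Num.max t 0); apply/cvgrPdist_le => e e0.
rewrite /dnbhs /= -nbhs_nearE; exists e => //= h; rewrite /ball_ /= sub0r normrN.
move=> he h0; apply: le_trans (ltW he).
(* The first-order remainder is at most [h ^+ 2], whatever the signs of [t] and [h + t]. *)
suff : `|2 * Num.max t 0 * h - (sqpos (h + t) - sqpos t)| <= `|h| * `|h|.
  have h0' : 0 < `|h| by rewrite normr_gt0.
  move=> H; rewrite -(ler_pM2r h0'); apply: le_trans H.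
  rewrite -normrM le_eqVlt; apply/orP; left.
  apply/eqP; congr `|_|; rewrite /= [h *: 1]mulr1 /GRing.scale /=.
  by field.
rewrite -normrM [`|h * h|]ger0_norm ?ler_norml; last by nra.
by rewrite /sqpos; case: (leP t 0) => ?; case: (leP (h + t) 0) => ?; nra.
Qed.

(* Equals [max_(0 <= w <= 1) w * a + (1 - w) * b + e * w * (1 - w)], and hence
   [Num.max a b] as soon as [a] and [b] differ by at least [e]. *)
Definition smax e a b : R :=
  b + (4 * e)^-1 * (sqpos (a - b + e) - sqpos (a - b - e)).

(** The weight is the critical point [(a - b + e) / (2 * e)] of the concave quadratic in [w],
    clipped to [0, 1]; the three cases are those of the clipping. *)
Lemma smaxP e a b : 0 < e ->
  exists2 w, 0 <= w <= 1 & smax e a b = w * a + (1 - w) * b + e * w * (1 - w).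
Proof.
move=> e0; have e1 : e != 0 by rewrite gt_eqF.
rewrite /smax /sqpos.
case: (leP (a - b + e) 0) => h1.
  by exists 0; [lra|rewrite max_r; [ring|lra]].
case: (leP (a - b - e) 0) => h2.
  exists ((a - b + e) / (2 * e)); last by field.
  rewrite divr_ge0 /=; [|lra|lra].
  by rewrite ler_pdivrMr; lra.
by exists 1; [lra|field].
Qed.

Lemma smax_ge e a b w : 0 < e -> 0 <= w <= 1 ->
  w * a + (1 - w) * b + e * w * (1 - w) <= smax e a b.
Proof.
move=> e0 w01; have e1 : e != 0 by rewrite gt_eqF.
rewrite /smax /sqpos -lerBlDl -(@ler_pM2l _ (4 * e)); last by lra.
rewrite mulrA divff ?mul1r; last by lra.
(* In the unclipped case this square is exactly [4 * e] times the gap to be shown nonnegative. *)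
have := sqr_ge0 (a - b + e - 2 * e * w).
case: (leP (a - b + e) 0) => h1.
  rewrite max_r; last by lra.
  have h2 : w * (a - b + e - e * w) <= 0 by apply: mulr_ge0_le0; nra.
  have := mulr_ge0_le0 (ltW e0) h2; lra.
case: (leP (a - b - e) 0) => h2; first by lra.
have h3 : 0 <= (1 - w) * (a - b - e * w) by apply: mulr_ge0; nra.
have := mulr_ge0 (ltW e0) h3; lra.
Qed.

Lemma smax_gel e a b : 0 < e -> a <= smax e a b.
Proof. by move=> e0; have := @smax_ge e a b 1 e0; lra. Qed.

Lemma smax_ger e a b : 0 < e -> b <= smax e a b.
Proof. by move=> e0; have := @smax_ge e a b 0 e0; lra. Qed.

Lemma smax_eql e a b : 0 < e -> b + e <= a -> smax e a b = a.
Proof.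
move=> e0 h; apply/le_anti; rewrite smax_gel // andbT.
have [w w01 ->] := smaxP a b e0.
have h1 : (1 - w) * (b - a + e) <= 0 by apply: mulr_ge0_le0; lra.
have h2 : 0 <= e * ((1 - w) * (1 - w)) by rewrite !mulr_ge0; lra.
lra.
Qed.

Lemma smax_eqr e a b : 0 < e -> a + e <= b -> smax e a b = b.
Proof.
move=> e0 h; apply/le_anti; rewrite smax_ger // andbT.
have [w w01 ->] := smaxP a b e0.
have h1 : w * (a - b + e) <= 0 by apply: mulr_ge0_le0; lra.
have h2 : 0 <= e * (w * w) by rewrite !mulr_ge0; lra.
lra.
Qed.

(** The correction [e * w * (1 - w)] stays below [e]. *)
Lemma smax_lt e a b c : 0 < e -> a + e < c -> b + e < c -> smax e a b < c.
Proof.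
move=> e0 ac bc; have [w w01 ->] := smaxP a b e0.
have h1 : w * (c - a - e) >= 0 by apply: mulr_ge0; lra.
have h2 : (1 - w) * (c - b - e) >= 0 by apply: mulr_ge0; lra.
have h3 : 0 <= e * (w * w) by rewrite !mulr_ge0; lra.
have h4 : 0 <= e * ((1 - w) * (1 - w)) by rewrite !mulr_ge0; lra.
have h5 : 0 <= e * (w * (1 - w)) by rewrite !mulr_ge0; lra.
have : 0 < e * (1 - w * (1 - w)) by apply: mulr_gt0; nra.
lra.
Qed.

(** For a fixed weight the expression is convex in [x]; the weight attaining the value at [z] is
    reused at [x] and [y], where it only gives a lower bound. *)
Lemma convex_smax n e (f g : 'rV[R]_n -> R) : 0 < e ->
  convex_fun f -> convex_fun g -> convex_fun (fun x => smax e (f x) (g x)).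
Proof.
move=> e0 cf cg x y t t01.
set z := t *: x + (1 - t) *: y.
have [w w01 ->] := smaxP (f z) (g z) e0.
have hx := smax_ge (f x) (g x) e0 w01; have hy := smax_ge (f y) (g y) e0 w01.
have hf : w * f z <= w * (t * f x + (1 - t) * f y).
  by apply: ler_wpM2l; [lra|exact: cf].
have hg : (1 - w) * g z <= (1 - w) * (t * g x + (1 - t) * g y).
  by apply: ler_wpM2l; [lra|exact: cg].
have t0 : 0 <= t by lra.
have t1 : 0 <= 1 - t by lra.
have := ler_wpM2l t0 hx; have := ler_wpM2l t1 hy; lra.
Qed.

Lemma differentiable_smax n e (f g : 'rV[R]_n -> R) :
  differentiable_fun f -> differentiable_fun g ->
  differentiable_fun (fun x => smax e (f x) (g x)).
Proof.
move=> df dg x.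
have dsq c : differentiable (sqpos \o (fun y => f y - g y + c) : _ -> R^o) x.
  apply: differentiable_comp; last exact: differentiable_sqpos.
  apply: differentiableD; last exact: differentiable_cst.
  exact: differentiableB.
apply: differentiableD; first exact: dg.
apply: differentiableZ; apply: differentiableB; [exact: (dsq e)|exact: (dsq (- e))].
Qed.

End SmoothMax.

(** Half the minimum works; the default [1] covers an empty [P]. *)
Lemma finite_margin (R : realType) (I : finType) (P : pred I) (a : I -> R) :
  (forall i, P i -> 0 < a i) -> exists2 e, 0 < e & forall i, P i -> e < a i.
Proof.
move=> a0; have m0 : 0 < \big[Num.min/1]_(i | P i) a i by apply: lt_bigmin.
exists (\big[Num.min/1]_(i | P i) a i / 2); first by rewrite divr_gt0.
move=> i Pi; have := bigmin_le_cond 1 a Pi; lra.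
Qed.

(** * Interpolating values and subgradients by convex functions *)

Section ConvexInterpolation.
Context {R : realType} {n : nat}.
Implicit Types (f h d : 'rV[R]_n -> R) (u x y g v : 'rV[R]_n).

Lemma affine_combination (c t : R) g u x y :
  c + dotv g (t *: x + (1 - t) *: y - u) =
  t * (c + dotv g (x - u)) + (1 - t) * (c + dotv g (y - u)).
Proof. by rewrite !dotvBr dotvDr !dotvZr; ring. Qed.

Lemma convex_affine (c : R) g u : convex_fun (fun x => c + dotv g (x - u)).
Proof. by move=> x y t _; rewrite affine_combination. Qed.

Lemma differentiable_affine (c : R) g u :
  differentiable_fun (fun x => c + dotv g (x - u)).
Proof.
move=> x; under eq_fun do rewrite dotvBr.
apply: differentiableD; first exact: differentiable_cst.
apply: differentiableB; last exact: differentiable_cst.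
exact: differentiable_dotv.
Qed.

(** The hypothesis says that no affine piece exceeds the prescribed value at a node, so at [x i] the
    maximum is attained by the piece of slope [g i]. *)
Lemma max_affine_interpolation (I : finType) (i0 : I) (x g : I -> 'rV[R]_n)
    (c : I -> R) :
  (forall i j, c j + dotv (g j) (x i - x j) <= c i) ->
  exists2 f, convex_fun f & forall i, f (x i) = c i /\ subdiff f (x i) (g i).
Proof.
move=> hc; pose l j y := c j + dotv (g j) (y - x j).
(* Taking one of the pieces as default value leaves the maximum unchanged. *)
pose f y := \big[Num.max/l i0 y]_j l j y.
have lf j y : l j y <= f y by apply: le_bigmax.
have fle y (b : R) : (forall j, l j y <= b) -> f y <= b.
  by move=> h; apply: bigmax_le.
exists f => [y z t t01|i].
  apply: fle => j; rewrite /l affine_combination.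
  by apply: lerD; apply: ler_wpM2l; rewrite ?lf //; lra.
have fx : f (x i) = c i.
  apply/le_anti; rewrite fle /=; last by move=> j; apply: hc.
  by apply: le_trans (lf i _); rewrite /l subrr dotv0r addr0.
by split=> // y; rewrite fx; apply: lf.
Qed.

(* The affine minorants are inserted one at a time: a smoothed maximum with a
   small enough parameter does not disturb the values at the other nodes. *)
Lemma smooth_interpolation (I : finType) (x g : I -> 'rV[R]_n) (c : I -> R) :
  (forall i j, i != j -> c j + dotv (g j) (x i - x j) < c i) ->
  exists f, [/\ convex_fun f, differentiable_fun f &
    forall i, f (x i) = c i /\ subdiff f (x i) (g i)].
Proof.
move=> hc; pose l j y := c j + dotv (g j) (y - x j).
have lx i : l i (x i) = c i.
  by rewrite /l subrr dotv0r addr0.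
(* Invariant: nodes in [r] are interpolated, and at the others [f] is still strictly below the
   target, which leaves room for later insertions. *)
suff: forall r : seq I, uniq r -> exists f, [/\ convex_fun f,
    differentiable_fun f,
    forall i, i \in r -> f (x i) = c i /\ forall y, l i y <= f y &
    forall i, i \notin r -> f (x i) < c i].
  case/(_ (enum I) (enum_uniq I)) => f [cf df fr _]; exists f; split=> // i.
  have [fx lf] := fr i (mem_enum I i).
  by split=> // y; rewrite fx; apply: lf.
elim=> [_|j r IHr /= /andP[jr ur]].
  pose m : R := - (1 + \sum_i `|c i|).
  exists (fun=> m); split=> [y z t t01|y||i _] //; first by lra.
  rewrite /m (bigD1 i) //=.
  have := ler_norm (- c i); rewrite normrN.
  have : 0 <= \sum_(k | k != i) `|c k| by apply: sumr_ge0.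
  lra.
have [f [cf df fr fnr]] := IHr ur.
(* [e1] keeps the new piece away from the targets at the other nodes; [e2] keeps the current
   function away from the targets not yet reached, including that of [j]. *)
have [e1 e10 he1] : exists2 e : R, 0 < e &
    forall i, i != j -> e < c i - l j (x i).
  by apply: finite_margin => i ij; have := hc i j ij; rewrite /l; lra.
have [e2 e20 he2] : exists2 e : R, 0 < e & forall i, i \notin r -> e < c i - f (x i).
  by apply: finite_margin => i ij; have := fnr i ij; lra.
pose e := Num.min e1 e2.
have e0 : 0 < e by rewrite lt_min e10.
have ee1 : e <= e1 by rewrite ge_min lexx.
have ee2 : e <= e2 by rewrite ge_min lexx orbT.
exists (fun y => smax e (f y) (l j y)); split.
- by apply: convex_smax => //; apply: convex_affine.
- by apply: differentiable_smax => //; apply: differentiable_affine.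
- move=> i; rewrite in_cons => /orP[/eqP ->|ir].
    split=> [|y]; last exact: smax_ger.
    rewrite smax_eqr // lx.
    have := he2 _ jr; lra.
  have ij : i != j by apply: contraNneq jr => <-.
  have [fx lf] := fr i ir; split=> [|y]; last exact: le_trans (lf y) (smax_gel _ _ _).
  rewrite smax_eql // fx; have := he1 i ij; lra.
- move=> i; rewrite in_cons negb_or => /andP[ij ir].
  by apply: smax_lt => //; [have := he2 i ir|have := he1 i ij]; lra.
Qed.

Lemma strictly_convexW f : strictly_convex_fun f -> convex_fun f.
Proof.
move=> sf x y t t01; have [->|xy] := eqVneq x y.
  by rewrite -scalerDl addrC subrK scale1r -mulrDl addrC subrK mul1r.
have [->|t0] := eqVneq t 0.
  by rewrite subr0 !(scale0r, scale1r, add0r, mul0r, mul1r).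
have [->|t1] := eqVneq t 1.
  by rewrite subrr !(scale0r, scale1r, addr0, mul0r, mul1r).
by apply/ltW/sf => //; rewrite !lt_neqAle t1 eq_sym t0 /=; lra.
Qed.

Lemma dotvv_combination (t : R) x y :
  dotv (t *: x + (1 - t) *: y) (t *: x + (1 - t) *: y) =
  t * dotv x x + (1 - t) * dotv y y - t * (1 - t) * dotv (x - y) (x - y).
Proof.
rewrite !(dotvBl, dotvBr, dotvDl, dotvDr, dotvZl, dotvZr) (dotvC y x); ring.
Qed.

Lemma strictly_convex_add_dotvv f (a : R) : 0 < a -> convex_fun f ->
  strictly_convex_fun (fun x => f x + a * dotv x x).
Proof.
move=> a0 cf x y t xy t01; rewrite dotvv_combination.
have := cf x y t; have -> : 0 <= t <= 1 by lra.
move/(_ isT) => h.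
have : 0 < a * (t * (1 - t) * dotv (x - y) (x - y)).
  by rewrite !mulr_gt0 ?dotv_gt0 ?subr_eq0 //; lra.
lra.
Qed.

(** The quadratic exceeds its tangent at [x] by [a * dotv (y - x) (y - x)]. *)
Lemma subdiff_add_dotvv f (a : R) x g : 0 <= a -> subdiff f x g ->
  subdiff (fun y => f y + a * dotv y y) x (g + (2 * a) *: x).
Proof.
move=> a0 sg y; have := sg y; rewrite dotvDl dotvZl.
have := mulr_ge0 a0 (dotv_ge0 (y - x)).
rewrite !(dotvBl, dotvBr) (dotvC y x); lra.
Qed.

Lemma subdiff_scaled_add f d (a : R) x g v : 0 <= a ->
  subdiff f x g -> subdiff d x v ->
  subdiff (fun y => a * (f y + d y)) x (a *: (g + v)).
Proof.
move=> a0 sf sd y; rewrite dotvZl dotvDl -mulrDr; apply: ler_wpM2l => //.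
have := sf y; have := sd y; lra.
Qed.

End ConvexInterpolation.

(** * Minimizers of coercive functions and the Bregman proximal step *)

Section Minimizers.
Context {R : realType} {n : nat}.
Implicit Types (f h : 'rV[R]_n -> R) (u x p : 'rV[R]_n).

(** Half of the quadratic term controls one coordinate, the other half absorbs [dotv b u] by
    completing the square. *)
Lemma dotv_coercive (b u : 'rV[R]_n) (a : R) (i : 'I_n) : 0 < a ->
  a / 2 * (u ord0 i * u ord0 i) - dotv b b / (2 * a) <= dotv b u + a * dotv u u.
Proof.
move=> a0; have a1 : a != 0 by rewrite gt_eqF.
have : a / 2 * (u ord0 i * u ord0 i) <= a / 2 * dotv u u.
  rewrite ler_pM2l; last by lra.
  rewrite /dotv (bigD1 i) //= lerDl; apply: sumr_ge0 => k _.
  by rewrite -expr2 sqr_ge0.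
have : 0 <= a / 2 * dotv (u + a^-1 *: b) (u + a^-1 *: b).
  by rewrite mulr_ge0 ?dotv_ge0 //; lra.
have -> : a / 2 * dotv (u + a^-1 *: b) (u + a^-1 *: b) =
    a / 2 * dotv u u + dotv b u + dotv b b / (2 * a).
  rewrite !(dotvDl, dotvDr, dotvZl, dotvZr) (dotvC u b).
  by field.
lra.
Qed.

(** The sublevel set at [f 0] is closed and bounded, hence compact. *)
Lemma coercive_minimizer f (c a : R) (b : 'rV[R]_n) :
  continuous (f : _ -> R^o) -> 0 < a ->
  (forall u, c + dotv b u + a * dotv u u <= f u) ->
  exists u, is_minimizer f u.
Proof.
move=> cf a0 lf.
pose A := [set u | f u <= f 0]%classic.
have A0 : A 0 by rewrite /A /=.
(* [K] bounds the squared coordinates on [A]; the cruder bound [1 + K] on their absolute values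
   avoids square roots. *)
pose K := (f 0 - c + dotv b b / (2 * a)) / (a / 2).
have coordK u i : A u -> `|u ord0 i| <= 1 + K.
  move=> Au; have := dotv_coercive b u i a0; have := lf u => h1 h2.
  have : u ord0 i * u ord0 i <= K.
    rewrite /K ler_pdivlMr; last by lra.
    by move: Au; rewrite /A /=; lra.
  move: (u ord0 i) => z hz; rewrite ler_norml.
  have := sqr_ge0 (z - 1); have := sqr_ge0 (z + 1); nra.
have Abnd : bounded_set A.
  exists (Num.max 0 (1 + K)); split; first exact: num_real.
  move=> M; rewrite gt_max => /andP[M0 M1] u Au.
  rewrite /Num.Def.normr /= mx_normrE; apply: bigmax_le => [|[i j] _ /=].
    exact: ltW.
  by rewrite ord1; apply: le_trans (ltW M1); apply: coordK.
have Acl : closed A.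
  have -> : A = (f @^-1` [set y | y <= f 0])%classic by [].
  by move/continuous_closedP: cf; apply; apply: closed_le.
have [u uA umin] := compact_EVT_min (ex_intro _ 0 A0)
  (bounded_closed_compact Abnd Acl) (continuous_subspaceT cf).
exists u => y; case: (leP (f y) (f 0)) => [fy|/ltW].
  by apply: umin; rewrite inE.
by apply: le_trans; move: uA; rewrite inE.
Qed.

Lemma strictly_convex_minimizer_unique f u x : strictly_convex_fun f ->
  is_minimizer f u -> is_minimizer f x -> u = x.
Proof.
move=> sf mu mx; apply/eqP/negPn/negP => ux.
have := sf u x (1 / 2) ux.
have := mu (1 / 2 *: u + (1 - 1 / 2) *: x); have := mu x; have := mx u.
lra.
Qed.

(** The objective is [lam^-1 * h] plus an affine function, so it inherits strict convexity and a
    quadratic lower bound. *)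
Lemma bregman_prox_unique h (c a : R) (b : 'rV[R]_n) (lam : R) x p :
  strictly_convex_fun h -> differentiable_fun h -> 0 < a -> 0 < lam ->
  (forall u, c + dotv b u + a * dotv u u <= h u) ->
  exists! u, is_minimizer (fun u => dotv p (u - x) + lam^-1 * Dh h u x) u.
Proof.
move=> sh dh a0 lam0 lh; have il0 : 0 < lam^-1 by rewrite invr_gt0.
pose f u := dotv p (u - x) + lam^-1 * Dh h u x.
have sf : strictly_convex_fun f.
  move=> y z t yz t01; have := sh y z t yz t01.
  rewrite -(ltr_pM2l il0) /f /Dh !dotvBr !dotvDr !dotvZr; lra.
have cf : continuous (f : _ -> R^o).
  move=> u; apply: (@differentiable_continuous R _ R^o).
  apply: differentiableD.
    by under eq_fun do rewrite -[dotv _ _]add0r; apply: differentiable_affine.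
  apply: differentiableZ; apply: differentiableB.
    by apply: differentiableB; [exact: dh|exact: differentiable_cst].
  by under eq_fun do rewrite -[dotv _ _]add0r; apply: differentiable_affine.
have [u mu] : exists u, is_minimizer f u.
  apply: (@coercive_minimizer f
    (lam^-1 * (c - h x + dotv (grad h x) x) - dotv p x) (lam^-1 * a)
    (p + lam^-1 *: (b - grad h x))) => //; first exact: mulr_gt0.
  move=> u; have := lh u; rewrite -(ler_pM2l il0) /f /Dh.
  rewrite !dotvBr !dotvDl !dotvZl dotvBl; lra.
by exists u; split=> // y my; apply: (strictly_convex_minimizer_unique sf).
Qed.

(** Differences of objective values are [lam^-1] times the subgradient gap of [h] at [u]. This turns
    a NoLips step into the linear recursion on the [s_i]. *)
Lemma bregman_proxP h (lam : R) x p u : 0 < lam ->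
  is_minimizer (fun y => dotv p (y - x) + lam^-1 * Dh h y x) u <->
  subdiff h u (grad h x - lam *: p).
Proof.
move=> lam0; have lam1 : lam != 0 by rewrite gt_eqF.
have eqv y : dotv p (y - x) + lam^-1 * Dh h y x -
    (dotv p (u - x) + lam^-1 * Dh h u x) =
    lam^-1 * (h y - (h u + dotv (grad h x - lam *: p) (y - u))).
  rewrite /Dh !dotvBl !dotvBr !dotvZl; field.
  exact: lam1.
split=> H y; have := H y.
  by rewrite -subr_ge0 eqv pmulr_rge0 ?invr_gt0 // subr_ge0.
by rewrite -subr_ge0 => hy; rewrite -subr_ge0 eqv pmulr_rge0 ?invr_gt0.
Qed.

End Minimizers.

(** * The linear system in the pairings, and its equivalence with (PEP-bar) and (SDP) *)

Section Discrete.
Context {R : realType} (N : nat) (L lam : R).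
Implicit Types (F H : Iset N -> R) (A B : Iset N -> Iset N -> R).

(* [A j i] and [B j i] stand for the pairings <g_j, x_i> and <s_j, x_i>. *)
Definition gapf F A i j : R := F i - F j - (A j i - A j j).

(** The analogue of [gapf] for [L * h - f], with subgradient [L *: s_j - g_j] at [x_j]. *)
Definition gapd F H A B i j : R :=
  (L * H i - F i) - (L * H j - F j) - (L * (B j i - B j j) - (A j i - A j j)).

Definition nolips_eqs H A B : Prop :=
  [/\ forall j, A (istar N) j = 0,
      forall k, (k < N)%N -> forall j,
        B (idx N k.+1) j = B (idx N k) j - lam * A (idx N k) j &
      H (istar N) - H (idx N 0) -
        (B (idx N 0) (istar N) - B (idx N 0) (idx N 0)) = 1].

Definition feasible F H A B : Prop :=
  nolips_eqs H A B /\
  forall i j, 0 <= gapf F A i j /\ 0 <= gapd F H A B i j.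

(** Both gaps vanish identically on the diagonal, so strictness is only possible off it. *)
Definition strictly_feasible F H A B : Prop :=
  nolips_eqs H A B /\
  forall i j, i != j -> 0 < gapf F A i j /\ 0 < gapd F H A B i j.

Lemma strictly_feasible_mix F H A B F' H' A' B' (e : R) : 0 < e <= 1 ->
  feasible F H A B -> strictly_feasible F' H' A' B' ->
  strictly_feasible (fun i => (1 - e) * F i + e * F' i)
    (fun i => (1 - e) * H i + e * H' i)
    (fun j i => (1 - e) * A j i + e * A' j i)
    (fun j i => (1 - e) * B j i + e * B' j i).
Proof.
move=> e01 [[A0 Bk D1] gap] [[A0' Bk' D1'] gap']; split.
  split=> [j|k kN j|]; first by rewrite A0 A0' !mulr0 addr0.
    by rewrite Bk // Bk' //; ring.
  by transitivity ((1 - e) * (H (istar N) - H (idx N 0) -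
        (B (idx N 0) (istar N) - B (idx N 0) (idx N 0))) +
      e * (H' (istar N) - H' (idx N 0) -
        (B' (idx N 0) (istar N) - B' (idx N 0) (idx N 0)))); [|rewrite D1 D1'];
    ring.
move=> i j ij; have [g1 g2] := gap i j; have [g1' g2'] := gap' i j ij.
have e0 : 0 < e by lra.
have e1 : 0 <= 1 - e by lra.
have := mulr_ge0 e1 g1; have := mulr_ge0 e1 g2.
have := mulr_gt0 e0 g1'; have := mulr_gt0 e0 g2'.
rewrite /gapf /gapd; lra.
Qed.

(* The data of gradient descent on a one-dimensional quadratic: h x = x^2,
   f x = (q / lam) x^2, x_k = (1 - q)^k and x_* = 0. *)
Lemma strictly_feasible_exists : 0 < L -> 0 < lam ->
  exists F H A B, strictly_feasible F H A B /\ F (istar N) <= F (idx N N).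
Proof.
move=> L0 lam0; have lam1 : lam != 0 by rewrite gt_eqF.
(* [q < 1] makes the points distinct, and [q < lam * L] gives [a < L]; the gaps become [a] and
   [L - a] times squared distances. *)
have [q q0 [q1 qL]] : exists2 q : R, 0 < q & q < 1 /\ q < lam * L.
  have m0 : 0 < Num.min 1 (lam * L) by rewrite lt_min ltr01 mulr_gt0.
  exists (Num.min 1 (lam * L) / 2); first by rewrite divr_gt0.
  have : Num.min 1 (lam * L) <= 1 by rewrite ge_min lexx.
  have : Num.min 1 (lam * L) <= lam * L by rewrite ge_min lexx orbT.
  by split; lra.
pose a := q / lam.
have a0 : 0 < a by rewrite divr_gt0.
have aL : a < L by rewrite ltr_pdivrMr // mulrC.
pose x (i : Iset N) : R := if i is Some k then (1 - q) ^+ k else 0.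
have x0 : x (idx N 0) = 1 by rewrite /x /= inordK.
have xk k : (k < N)%N -> x (idx N k.+1) = (1 - q) * x (idx N k).
  by move=> kN; rewrite /x /= !inordK ?ltnS ?exprS // ltnW.
have xinj i j : i != j -> 0 < (x i - x j) ^+ 2.
  move=> ij; rewrite lt_neqAle sqr_ge0 andbT eq_sym sqrf_eq0 subr_eq0.
  apply: contra ij; case: i j => [i|] [j|] //=.
  - rewrite eq_sym -subr_eq0 => H; apply/eqP; congr Some; apply/val_inj => /=.
    have [ij|ij|//] := ltngtP i j.
      have : (1 - q) ^+ j < (1 - q) ^+ i by rewrite ltr_iXn2l //; lra.
      by move: H; rewrite subr_eq0 => /eqP ->; rewrite ltxx.
    have : (1 - q) ^+ i < (1 - q) ^+ j by rewrite ltr_iXn2l //; lra.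
    by move: H; rewrite subr_eq0 => /eqP ->; rewrite ltxx.
  - by rewrite expf_eq0 => /andP[_]; rewrite gt_eqF //; lra.
  - by rewrite eq_sym expf_eq0 => /andP[_]; rewrite gt_eqF //; lra.
exists (fun i => a * x i ^+ 2), (fun i => x i ^+ 2),
  (fun j i => 2 * a * (x j * x i)), (fun j i => 2 * (x j * x i)); split.
- split; first split.
  + by move=> j; rewrite /x /= mul0r mulr0.
  + move=> k kN j; rewrite xk // /a; field.
    exact: lam1.
  + by rewrite x0 /x /=; ring.
  + move=> i j /xinj xij; split.
      have -> : gapf (fun i => a * x i ^+ 2) (fun j i => 2 * a * (x j * x i)) i j =
        a * (x i - x j) ^+ 2 by rewrite /gapf; ring.
      exact: mulr_gt0.
    rewrite (_ : gapd _ _ _ _ _ _ = (L - a) * (x i - x j) ^+ 2).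
      by rewrite mulr_gt0 // subr_gt0.
    by rewrite /gapd; ring.
- by rewrite {1}/x /= expr0n mulr0 mulr_ge0 ?sqr_ge0 // ltW.
Qed.

(** Apart from the normalization the system is homogeneous. The factor [c] is [1] for (PEP-bar) and
    the inverse Bregman distance for (PEP). *)
Lemma feasible_of_functions n (f h : 'rV[R]_n -> R) (x g s : Iset N -> 'rV[R]_n)
    (c : R) : 0 <= c ->
  (forall i, subdiff f (x i) (g i)) ->
  (forall i, subdiff (fun y => L * h y - f y) (x i) (L *: s i - g i)) ->
  g (istar N) = 0 ->
  (forall k, (k < N)%N -> s (idx N k.+1) = s (idx N k) - lam *: g (idx N k)) ->
  c * (h (x (istar N)) - h (x (idx N 0)) -
       dotv (s (idx N 0)) (x (istar N) - x (idx N 0))) = 1 ->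
  feasible (fun i => c * f (x i)) (fun i => c * h (x i))
    (fun j i => c * dotv (g j) (x i)) (fun j i => c * dotv (s j) (x i)).
Proof.
move=> c0 sf sd g0 sk D1; split.
  split=> [j|k kN j|]; first by rewrite g0 dotv0l mulr0.
    by rewrite sk // dotvBl dotvZl; ring.
  by rewrite -D1 dotvBr; ring.
move=> i j.
have := ler_wpM2l c0 (sf j (x i)); have := ler_wpM2l c0 (sd j (x i)).
by rewrite !dotvBr !dotvBl !dotvZl /gapf /gapd => h1 h2; split; lra.
Qed.

Definition discrete_values : set R :=
  [set r | exists F H A B,
    feasible F H A B /\ r = F (idx N N) - F (istar N)]%classic.

Lemma feasible_value_ge0 F H A B : feasible F H A B ->
  0 <= F (idx N N) - F (istar N).
Proof.
move=> [[A0 _ _]] /(_ (idx N N) (istar N))[+ _].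
by rewrite /gapf !A0 subrr subr0.
Qed.

(* The nodes are the canonical basis vectors of R^I, so that any matrix of
   pairings is realized. *)
Definition node (i : Iset N) : 'rV[R]_#|{: Iset N}| := delta_mx 0 (enum_rank i).

Definition pairing_vec (a : Iset N -> R) : 'rV[R]_#|{: Iset N}| :=
  \row_k a (enum_val k).

Lemma pairing_vecE a i : dotv (pairing_vec a) (node i) = a i.
Proof. by rewrite dotv_delta mxE enum_rankK. Qed.

Lemma card_Iset_gt0 : (0 < #|{: Iset N}|)%N.
Proof. by apply/card_gt0P; exists None. Qed.

(** Since the nodes are equidistant, a term [a * dotv y y] costs every off-diagonal gap the same
    amount [2 * a]. *)
Lemma dotv_nodeB i j : i != j -> dotv (node i - node j) (node i - node j) = 2.
Proof.
move=> ij; have e k l : dotv (node k) (node l) = (k == l)%:R.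
  by rewrite dotv_delta mxE eqxx (inj_eq enum_rank_inj) eq_sym.
rewrite !(dotvBl, dotvBr) !e !eqxx [j == i]eq_sym (negbTE ij) mulr1n mulr0n; ring.
Qed.

Lemma recovered_subgradient n (a : R) (g s : 'rV[R]_n) : a != 0 ->
  a^-1 *: (g + (a *: s - g)) = s.
Proof. by move=> a0; rewrite addrCA subrr addr0 scalerA mulVf // scale1r. Qed.

(** [f] and [d], standing for [L * h - f], are interpolated separately; then [h] is recovered as
    [L^-1 * (f + d)]. *)
Lemma discrete_sub_PEPbar : 0 < L ->
  (discrete_values `<=` PEPbar_values N L lam)%classic.
Proof.
move=> L0 r [F [H [A [B [[[A0 Bk D1] gap] ->]]]]].
have L1 : L != 0 by rewrite gt_eqF.
pose g j := pairing_vec (A j); pose s j := pairing_vec (B j).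
have [f cf fx] : exists2 f, convex_fun f &
    forall i, f (node i) = F i /\ subdiff f (node i) (g i).
  apply: (max_affine_interpolation None) => i j.
  rewrite dotvBr !pairing_vecE; have [+ _] := gap i j; rewrite /gapf; lra.
have [d cd dx] : exists2 d, convex_fun d & forall i,
    d (node i) = L * H i - F i /\ subdiff d (node i) (L *: s i - g i).
  apply: (max_affine_interpolation None) => i j.
  rewrite dotvBr !dotvBl !dotvZl !pairing_vecE; have [_] := gap i j; rewrite /gapd; lra.
exists #|{: Iset N}|, node, F, g, H, s; split=> //.
- exact: card_Iset_gt0.
- exists f, (fun y => L^-1 * (f y + d y)).
  have -> : (fun y => L * (L^-1 * (f y + d y)) - f y) = d.
    by apply: boolp.funext => y; rewrite mulVKf // addrC addKr.
  split=> // i; have [fi sfi] := fx i; have [di sdi] := dx i; split=> //.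
    by rewrite fi di; field.
  rewrite -[s i](recovered_subgradient (g i) _ L1).
  by apply: subdiff_scaled_add => //; rewrite invr_ge0 ltW.
- split; first by apply/rowP => k; rewrite !mxE A0.
  by move=> k kN; apply/rowP => l; rewrite !mxE Bk.
- by rewrite dotvBr !pairing_vecE.
Qed.

Lemma PEPbar_sub_discrete :
  (PEPbar_values N L lam `<=` discrete_values)%classic.
Proof.
move=> _ [n [x [fv [g [hv [s [_ [f [h [_ _ fh]]] [g0 sk] D1 ->]]]]]]].
exists (fun i => 1 * f (x i)), (fun i => 1 * h (x i)),
  (fun j i => 1 * dotv (g j) (x i)), (fun j i => 1 * dotv (s j) (x i)).
split; last by rewrite !mul1r; have [-> _ _ _ _] := fh (idx N N);
  have [-> _ _ _ _] := fh (istar N).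
apply: feasible_of_functions => // [i|i|]; try by have [] := fh i.
rewrite mul1r -D1; have [_ _ -> _ _] := fh (istar N).
by have [_ _ -> _ _] := fh (idx N 0).
Qed.

Lemma PEPbar_sub_SDP : (PEPbar_values N L lam `<=` SDP_values N L lam)%classic.
Proof.
move=> _ [n [x [fv [g [hv [s [_ [f [h [_ _ fh]]] [g0 sk] D1 ->]]]]]]].
pose w (p : 'I_3 * Iset N) :=
  if p.1 == cx then x p.2 else if p.1 == cg then g p.2 else s p.2.
have wx i : w (cx, i) = x i by rewrite /w eqxx.
have wg i : w (cg, i) = g i by rewrite /w /= -val_eqE /= !inordK // eqxx.
have ws i : w (cs, i) = s i by rewrite /w /= -!val_eqE /= !inordK.
exists fv, hv, (fun p q => dotv (w p) (w q)); split=> //.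
- split=> [k l|v]; first exact: dotvC.
  (* The quadratic form of a Gram matrix is a squared norm. *)
  suff -> : \sum_k \sum_l v k * dotv (w k) (w l) * v l =
    dotv (\sum_k v k *: w k) (\sum_k v k *: w k) by exact: dotv_ge0.
  have dotv_suml y : dotv (\sum_k v k *: w k) y = \sum_k v k * dotv (w k) y.
    by elim/big_rec2: _ => [|k ? ? _ <-]; rewrite ?dotv0l // dotvDl dotvZl.
  rewrite dotv_suml; apply: eq_bigr => k _.
  rewrite dotvC dotv_suml mulr_sumr; apply: eq_bigr => l _.
  by rewrite (dotvC (w l)); ring.
- move=> i j; rewrite !wx !wg !ws.
  have [-> _ -> _ _] := fh i; have [-> sf -> _ sd] := fh j.
  have := sf (x i); have := sd (x i); rewrite !dotvBr !dotvBl !dotvZl.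
  by move=> h1 h2; split; lra.
- split; first by rewrite wg g0 dotv0l.
  by move=> k kN j; rewrite !wx !wg !ws sk // dotvBl dotvZl.
- by rewrite !wx !ws -D1 dotvBr; ring.
Qed.

(** On [t] times the [k]-th unit vector plus the [l]-th, the form is affine in [t]; being
    nonnegative for all [t], it has slope zero. *)
Lemma sym_psd_row_eq0 (K : finType) (G : K -> K -> R) k l :
  sym_psd G -> G k k = 0 -> G k l = 0.
Proof.
move=> [symG psdG] Gkk; have [<-//|kl] := eqVneq k l.
have quad t : 0 <= 2 * t * G k l + G l l.
  have := psdG (fun i => t * (i == k)%:R + (i == l)%:R).
  have delta (T : K -> R) (a : R) :
      \sum_i (a * (i == k)%:R + (i == l)%:R) * T i = a * T k + T l.
    transitivity (\sum_i (a * ((i == k)%:R * T i) + (i == l)%:R * T i)).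
      by apply: eq_bigr => i _; ring.
    rewrite big_split /= -mulr_sumr (bigD1 k) //= eqxx mul1r big1 ?addr0.
      rewrite (bigD1 l) //= eqxx mul1r big1 ?addr0 // => i /negbTE->.
      by rewrite mul0r.
    by move=> i /negbTE->; rewrite mul0r.
  under eq_bigr => i _ do under eq_bigr => j _ do rewrite -mulrA [G i j * _]mulrC.
  under eq_bigr => i _ do rewrite -mulr_sumr delta.
  by rewrite delta Gkk (symG l k); lra.
apply/eqP; apply: contraT => G0.
(* This [t] would give the form the value -1. *)
have := quad (- (G l l + 1) / (2 * G k l)).
have -> : 2 * (- (G l l + 1) / (2 * G k l)) * G k l = - (G l l + 1).
  by field.
lra.
Qed.

Lemma SDP_sub_discrete : (SDP_values N L lam `<=` discrete_values)%classic.
Proof.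
move=> _ [F [H [G [psdG gap [Gg0 Gk] D1 ->]]]].
exists F, H, (fun j i => G (cg, j) (cx, i)), (fun j i => G (cs, j) (cx, i)).
split=> //; split; last by move=> i j; have [] := gap i j;
  rewrite /gapf /gapd => h1 h2; split; lra.
split=> [j|//|]; first exact: sym_psd_row_eq0.
by rewrite -D1; ring.
Qed.

End Discrete.

(** * Between the linear system and (PEP) *)

Section PEP.
Context {R : realType} (N : nat) (L lam : R).

(** Same construction as for (PEP-bar), with smooth interpolants and with [D], which contains a
    quadratic, in the role of [L * h - f]. *)
Lemma strictly_feasible_PEP F H A B : 0 < L -> 0 < lam ->
  strictly_feasible L lam F H A B ->
  PEP_values N L lam (F (idx N N) - F (istar N)).
Proof.
move=> L0 lam0 [[A0 Bk D1] gap].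
have L1 : L != 0 by rewrite gt_eqF.
have iL0 : 0 < L^-1 by rewrite invr_gt0.
pose g j := pairing_vec (A j); pose s j := pairing_vec (B j).
have g0 : g (istar N) = 0 by apply/rowP => k; rewrite !mxE A0.
have sk k : (k < N)%N -> s (idx N k.+1) = s (idx N k) - lam *: g (idx N k).
  by move=> kN; apply/rowP => l; rewrite !mxE Bk.
have [f [cf df fx]] : exists f, [/\ convex_fun f, differentiable_fun f &
    forall i, f (node i) = F i /\ subdiff f (node i) (g i)].
  apply: smooth_interpolation => i j /gap[+ _].
  by rewrite dotvBr !pairing_vecE /gapf; lra.
have [e e0 he] : exists2 e : R, 0 < e & forall p : Iset N * Iset N,
    p.1 != p.2 -> e < gapd L F H A B p.1 p.2.
  by apply: finite_margin => -[i j] /gap[].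
(* Room for the quadratic term which makes h strictly convex and coercive. *)
pose a := e / 2; have a0 : 0 < a by rewrite divr_gt0.
pose v i := L *: s i - g i.
(* The quadratic's values and gradients are subtracted in advance, so that [D] has the intended data
   at the nodes. *)
have [d [cd dd dx]] : exists d, [/\ convex_fun d, differentiable_fun d &
    forall i, d (node i) = L * H i - F i - a * dotv (node i) (node i) /\
      subdiff d (node i) (v i - (2 * a) *: node i)].
  apply: smooth_interpolation => i j ij.
  have := he (i, j) ij; have := @dotv_nodeB R N i j ij.
  rewrite /gapd /= !(dotvBl, dotvBr, dotvZl) !pairing_vecE (dotvC (node j) (node i)).
  rewrite -[e](divfK (_ : 2 != 0)) // -/a => h2.
  have := congr1 ( *%R a) h2; lra.
pose D y := d y + a * dotv y y.
have cD : strictly_convex_fun D by apply: strictly_convex_add_dotvv.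
have dD : differentiable_fun D.
  move=> y; apply: differentiableD; first exact: dd.
  by apply: differentiableZ; apply: differentiable_dotvv.
have sD i : subdiff D (node i) (v i).
  have [_ /(subdiff_add_dotvv (ltW a0))] := dx i.
  by rewrite subrK.
pose h y := L^-1 * (f y + D y).
have hE : (fun y => L * h y - f y) = D.
  by apply: boolp.funext => y; rewrite /h mulVKf // addrC addKr.
have hx i : h (node i) = H i.
  by rewrite /h /D; have [-> _] := fx i; have [-> _] := dx i; field.
have sh i : subdiff h (node i) (s i).
  rewrite -[s i](recovered_subgradient (g i) _ L1).
  by apply: subdiff_scaled_add; [exact: ltW|have [] := fx i|exact: sD].
have dh : differentiable_fun h.
  move=> y; apply: differentiableZ; apply: differentiableD; [exact: df|exact: dD].
have ch : strictly_convex_fun h.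
  move=> x y t xy t01; have := cD x y t xy t01.
  have := cf x y t; have -> : 0 <= t <= 1 by lra.
  move=> /(_ isT) h1 h2.
  have : 0 < L^-1 * (t * f x + (1 - t) * f y + (t * D x + (1 - t) * D y)
     - (f (t *: x + (1 - t) *: y) + D (t *: x + (1 - t) *: y))).
    by rewrite mulr_gt0 //; lra.
  rewrite /h; lra.
have gradf i : grad f (node i) = g i.
  by apply: subdiff_grad => //; have [] := fx i.
have gradh i : grad h (node i) = s i by apply: subdiff_grad.
have fmin : is_minimizer f (node (istar N)).
  by move=> y; have [_ /(_ y)] := fx (istar N); rewrite g0 dotv0l addr0.
exists #|{: Iset N}|, f, h, (node (idx N 0)), (node (istar N)),
  (fun k => node (idx N k)); split=> //.
- exact: card_Iset_gt0.
- split=> //.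
  + by split=> //; split=> //; exists (node (istar N)).
  + by rewrite hE; apply: strictly_convexW.
  + move=> lam' x p lam'0.
    (* Lower bound for [h]: [f] is at least its minimum, [d] at least its affine minorant of slope
       [w], and the quadratic remains. *)
    pose w := v (istar N) - (2 * a) *: node (istar N).
    apply: (@bregman_prox_unique _ _ h (L^-1 * (f (node (istar N)) +
      d (node (istar N)) - dotv w (node (istar N)))) (L^-1 * a) (L^-1 *: w)) => //.
      exact: mulr_gt0.
    move=> u; rewrite dotvZl -mulrA -!mulrDr ler_pM2l // /D.
    have := fmin u; have [_ /(_ u)] := dx (istar N); rewrite -/w dotvBr; lra.
- split=> // k kN; apply/bregman_proxP => //.
  by rewrite gradh gradf -sk.
- rewrite /Dh gradh !hx dotvBr !pairing_vecE D1 divr1.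
  by have [-> _] := fx (idx N N); have [-> _] := fx (istar N).
Qed.

Lemma PEP_discrete r : 0 < lam -> PEP_values N L lam r ->
  r = 0 \/ discrete_values N L lam r.
Proof.
move=> lam0 [n [f [h [x0 [xstar [xs [_ Bfh fmin [xs0 iter] ->]]]]]]].
have [[cf [df _]] [sh dh] cd _] := Bfh.
have ch := strictly_convexW sh.
(* A zero denominator gives ratio 0; otherwise all data are divided by it. *)
have [->|D0] := eqVneq (Dh h xstar x0) 0; first by left; rewrite invr0 mulr0.
have Dge0 : 0 <= Dh h xstar x0.
  by have := grad_subdiff ch (dh x0) xstar; rewrite /Dh; lra.
pose x (i : Iset N) := if i is Some k then xs k else xstar.
have xk k : (k <= N)%N -> x (idx N k) = xs k by move=> kN; rewrite /x /= inordK.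
right; pose c := (Dh h xstar x0)^-1.
exists (fun i => c * f (x i)), (fun i => c * h (x i)),
  (fun j i => c * dotv (grad f (x j)) (x i)), (fun j i => c * dotv (grad h (x j)) (x i)).
split; last by rewrite xk // -mulrBr mulrC.
apply: (@feasible_of_functions _ _ _ _ _ f h x (grad f \o x) (grad h \o x)).
- by rewrite invr_ge0.
- by move=> i; apply: grad_subdiff.
- move=> i /=; rewrite -gradZB //; apply: grad_subdiff => //.
  by apply: differentiableB; [apply: differentiableZ; apply: dh|apply: df].
- apply: subdiff_grad => // y; rewrite dotv0l addr0; exact: fmin.
- move=> k kN; rewrite /comp !xk ?(ltnW kN) //.
  by apply: subdiff_grad => //; apply/bregman_proxP => //; apply: iter.
- by rewrite /comp xk // xs0; apply: mulVf.
Qed.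

End PEP.

(** * Equality of the three optimal values *)

Theorem theorem4p5 (R : realType) (N : nat) (L lam : R) :
  (1 <= N)%N -> 0 < L -> 0 < lam ->
  val_PEP N L lam = val_PEPbar N L lam /\ val_PEPbar N L lam = val_SDP N L lam.
Proof.
move=> _ L0 lam0.
have PEPbarE : PEPbar_values N L lam = discrete_values N L lam.
  by apply/seteqP; split; [exact: PEPbar_sub_discrete|exact: discrete_sub_PEPbar].
have SDPE : SDP_values N L lam = discrete_values N L lam.
  apply/seteqP; split; first exact: SDP_sub_discrete.
  by rewrite -PEPbarE; exact: PEPbar_sub_SDP.
rewrite /val_PEPbar /val_SDP PEPbarE SDPE; split=> //.
have [F' [H' [A' [B' [sf' F'ge]]]]] := @strictly_feasible_exists R N L lam L0 lam0.
apply/le_anti/andP; split; apply: ge_ereal_sup => _ [r + <-].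
  (* A ratio 0 is dominated by the nonnegative value of the strictly feasible point. *)
  case/(PEP_discrete lam0) => [->|rd]; last first.
    by apply: ereal_sup_ubound; exists r.
  apply: (@le_trans _ _ (F' (idx N N) - F' (istar N))%:E).
    by rewrite lee_fin subr_ge0.
  apply: ereal_sup_ubound; exists (F' (idx N N) - F' (istar N)) => //.
  exists F', H', A', B'; split=> //; case: sf' => eqs gap; split=> // i j.
  have [<-|/gap[/ltW ? /ltW ?]//] := eqVneq i j.
  by rewrite /gapf /gapd !subrr mulr0 !subr0.
move=> [F [H [A [B [fs rE]]]]].
have r0 : 0 <= r by rewrite rE; apply: feasible_value_ge0 fs.
(* The mixture has value [(1 - e) * r] plus [e] times a nonnegative number, and strict feasibility
   makes it a (PEP) value. *)
have approx e : 0 < e <= 1 -> (((1 - e) * r)%:E <= val_PEP N L lam)%E.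
  move=> e01; have mix := strictly_feasible_mix e01 fs sf'.
  have /= inPEP := strictly_feasible_PEP L0 lam0 mix.
  apply: le_trans (ereal_sup_ubound (ex_intro2 _ _ _ inPEP erefl)).
  rewrite lee_fin rE.
  have : 0 <= e * (F' (idx N N) - F' (istar N)) by rewrite mulr_ge0 ?subr_ge0 //; lra.
  lra.
move: approx; rewrite -/(val_PEP N L lam); case: (val_PEP N L lam) => [m||] approx.
- rewrite lee_fin leNgt; apply/negP => mr.
  have m0 : 0 <= m by have := approx 1; rewrite subrr mul0r lee_fin; apply; lra.
  have rp : 0 < r by apply: le_lt_trans mr.
  (* With this [e], [(1 - e) * r] is the midpoint of [m] and [r], which exceeds [m]. *)
  have := approx ((r - m) / (2 * r)).
  rewrite divr_gt0 /=; [|lra|lra]; rewrite ler_pdivrMr; last by lra.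
  have -> : r - m <= 1 * (2 * r) by lra.
  rewrite lee_fin => /(_ isT).
  have -> : (1 - (r - m) / (2 * r)) * r = (r + m) / 2 by field; lra.
  lra.
- exact: leey.
- by have := approx 1; rewrite ltr01 lexx => /(_ isT).
Qed.
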